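(* Let $H$ be a random $n\times n$ real symmetric positive semi-definite matrix such that $G=\mathbb{E}[H]$ exists and is positive definite. Let $f:\mathbb{R}^n\to\mathbb{R}$ be differentiable, and $\mu$-strongly convex with $\mu>0$ with respect to the $\|\cdot\|_{G^{-1}}$ norm. Suppose further that $f$ has $1$-Lipschitz gradients with respect to the $\|\cdot\|_{G^{-1}}$ norm, and that for every fixed $x\in\mathbb{R}^n$, $$f(\Phi(x;H)) \leq f(x) - \tfrac12\|\nabla f(x)\|_H^2\quad\text{holds for a.e. } H,\qquad\text{where } \Phi(x;H) = x - H\nabla f(x).$$ Let $\nu = \lambda_{\max}\left(\mathbb{E}\left[(G^{-1/2}HG^{-1/2})^2\right]\right)$ and $\tau=\sqrt{\mu/\nu}$. Let $H_0,H_1,\dots$ be independent realizations of $H$, and, starting from fixed (non-random) initial points, let $\{(x_k,y_k,z_k)\}_{k\ge0}$ be defined by $$x_{k+1} = \tfrac{1}{1+\tau}y_k + \tfrac{\tau}{1+\tau}z_k,$$ $$y_{k+1} = x_{k+1} - H_k\nabla f(x_{k+1}),$$ $$z_{k+1} = z_k + \tau(x_{k+1}-z_k) - \tfrac{\tau}{\mu}H_k\nabla f(x_{k+1}).$$ With $f_*=\min_x f(x)$ attained at $x_*$, put $V_k = f(y_k) - f_* + \frac{\mu}{2}\|z_k-x_*\|_{G^{-1}}^2$. Then for every $k\geq 0$, $$\mathbb{E}[V_k]\leq(1-\tau)^kV_0.$$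
   Context: For positive definite $M$, $\|x\|_M=\sqrt{x^{T}Mx}$; for positive semi-definite $M$ the same formula defines a seminorm, and $M^{1/2}$ is the positive semi-definite square root. $f$ being $\mu$-strongly convex with respect to $\|\cdot\|_{G^{-1}}$ means $f(y)\ge f(x)+\langle\nabla f(x),y-x\rangle+\frac{\mu}{2}\|y-x\|_{G^{-1}}^2$ for all $x,y\in\mathbb{R}^n$. $f$ having $L$-Lipschitz gradients with respect to $\|\cdot\|_{G^{-1}}$ means $f(y)\le f(x)+\langle\nabla f(x),y-x\rangle+\frac{L}{2}\|y-x\|_{G^{-1}}^2$ for all $x,y\in\mathbb{R}^n$. Here $\langle\cdot,\cdot\rangle$ is the Euclidean inner product and $\nabla f$ the usual Euclidean gradient. $\lambda_{\max}$ denotes the largest eigenvalue. The expectation defining $\nu$ is assumed to exist (be finite). *)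

(* Defs.v *)
From HB Require Import structures.
From mathcomp Require Import all_boot all_order all_algebra.
From mathcomp Require Import finmap.
From mathcomp Require Import all_classical all_reals all_analysis.

Set Implicit Arguments.
Unset Strict Implicit.
Unset Printing Implicit Defensive.

Import Order.TTheory GRing.Theory Num.Theory.
Import numFieldNormedType.Exports.

Local Open Scope classical_set_scope.
Local Open Scope ring_scope.

Section LinearAlgebra.
Variables (R : realType) (n : nat).
Implicit Types (M : 'M[R]_n) (x y : 'cV[R]_n).

Definition dotv x y : R := (x^T *m y) ord0 ord0.

Definition qform M x : R := dotv x (M *m x).

Definition psdmx M : Prop := M^T = M /\ forall x, 0 <= qform M x.

Definition pdmx M : Prop := M^T = M /\ forall x, x != 0 -> 0 < qform M x.

Definition normmx M x : R := Num.sqrt (qform M x).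

(* For [M] positive semi-definite the set below is a singleton. *)
Definition sqrtmx M : 'M[R]_n := xget 0 [set S | psdmx S /\ S *m S = M].

(* The set of eigenvalues is finite, so whenever it is nonempty (as for [M]
   symmetric and [0 < n]) this supremum is a maximum. *)
Definition lambda_max M : R := sup [set a | eigenvalue M a].

End LinearAlgebra.

Section Functions.
Variables (R : realType) (n : nat).
Implicit Types (f : 'cV[R]_n -> R) (M : 'M[R]_n) (x y : 'cV[R]_n).

Definition grad f x : 'cV[R]_n := \col_i 'D_(delta_mx i ord0) f x.

Definition strongly_convex f (mu : R) M : Prop :=
  forall x y,
    f x + dotv (grad f x) (y - x) + mu / 2 * normmx M (y - x) ^+ 2 <= f y.

Definition lipschitz_gradient f (L : R) M : Prop :=
  forall x y,
    f y <= f x + dotv (grad f x) (y - x) + L / 2 * normmx M (y - x) ^+ 2.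

End Functions.

(* Square matrices with the Borel sigma-algebra of their usual topology. *)
Notation borel_mx R n := (g_sigma_algebraType (@open 'M[R]_n)).

Section Probability.
Context {R : realType} {d : measure_display} {T : measurableType d}.
Variable P : probability T R.

Definition integrable_mx n (X : T -> 'M[R]_n) : Prop :=
  forall i j, P.-integrable [set: T] (fun w => (X w i j)%:E).

Definition mean_mx n (X : T -> 'M[R]_n) : 'M[R]_n :=
  \matrix_(i, j) fine 'E_P[fun w => X w i j].

Definition mutually_independent d' (T' : measurableType d')
    (X : nat -> {RV P >-> T'}) : Prop :=
  forall (J : {fset nat}) (B : nat -> set T'),
    (forall k, measurable (B k)) ->
    P (\bigcap_(k in [set` J]) (X k @^-1` B k)) =
    (\prod_(k <- J) P (X k @^-1` B k))%E.

End Probability.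

Definition same_law (R : realType) d1 d2 d'
    (T1 : measurableType d1) (T2 : measurableType d2) (T' : measurableType d')
    (P1 : probability T1 R) (P2 : probability T2 R)
    (X1 : {RV P1 >-> T'}) (X2 : {RV P2 >-> T'}) : Prop :=
  forall B : set T', measurable B -> distribution P1 X1 B = distribution P2 X2 B.

(* Main.v *)
Require Import Defs.
From HB Require Import structures.
From mathcomp Require Import all_boot all_order all_algebra.
From mathcomp Require Import finmap.
From mathcomp Require Import all_classical all_reals all_analysis.
From mathcomp Require Import measurable_realfun complex spectral ring lra.

Set Implicit Arguments.
Unset Strict Implicit.
Unset Printing Implicit Defensive.

Import Order.TTheory GRing.Theory Num.Theory.
Import numFieldNormedType.Exports.

Local Open Scope classical_set_scope.
Local Open Scope ring_scope.

(** Write [|v|_M] for the (semi)norm of [M], [g] for the gradient of [f] at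
    the point [x_{k+1}], and
    [u = (1 - tau) (z_k - xstar) + tau (x_{k+1} - xstar)], so that
    [z_{k+1} - xstar = u - (tau / mu) H_k g].

    The proof bounds the mean of [V_{k+1}] when [(y_k, z_k)] is held fixed and
    only [H_k] varies. The descent property bounds [f (y_{k+1})] by
    [f (x_{k+1}) - |g|_H^2 / 2], whose mean is [f (x_{k+1}) - |g|_G^2 / 2].
    Expanding [|z_{k+1} - xstar|^2] in the norm of [G^-1] gives [|u|^2], a
    cross term with mean [- 2 (tau / mu) <u, g>], because [E H = G], and the
    second-order term [(tau / mu)^2 |H g|^2]. The latter is the quadratic form
    of [(G^-1/2 H G^-1/2)^2] at [G^1/2 g], so its mean is at most
    [(tau / mu)^2 nu |g|_G^2] ([second_moment_le]). Multiplied by [mu / 2]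
    this is exactly [|g|_G^2 / 2], by the choice [tau^2 = mu / nu], and it
    cancels the gain of the descent step. What remains is free of randomness,
    and the strong convexity of [f] with the convexity of the squared norm
    bounds it by [(1 - tau) V_k] ([accelerated_estimate],
    [one_step_contraction]).

    Convexity is used with weights [tau] and [1 - tau], so [tau <= 1] is
    needed: [mu <= 1] since the lower quadratic model of [f] lies below the
    upper one ([strong_convexity_le1]), and [1 <= nu] since [G^-1/2 H G^-1/2]
    has mean the identity and its second moment dominates the square of its
    mean ([second_moment_ge]).

    Two points of rigour remain. First, [sqrtmx] and [lambda_max] are defined
    by a choice and by a supremum; that they behave as expected rests on the
    spectral theorem for real symmetric matrices ([real_spectral]). Secondly,
    the passage from one step to [k] steps integrates over the law of
    [(y_k, z_k)], because independence makes the joint law of [(y_k, z_k)] and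
    [H_k] a product ([markov_contraction]). This requires the update to be a
    Borel map, hence the gradient to be measurable; it is even Lipschitz, by
    convexity and the upper quadratic model ([gradient_lipschitz]). *)

(** * Spectral decomposition of real symmetric matrices *)

(** Over the complex numbers a real symmetric matrix is Hermitian, so it has a
   real eigenvalue there; being an eigenvalue does not depend on the field. *)
Lemma symmetric_eigenvalue (R : rcfType) n (M : 'M[R]_n.+1) :
  M^T = M -> exists a, eigenvalue M a.
Proof.
move=> Msym; pose MC := map_mx (real_complex R) M.
have Mherm : MC \is hermsymmx.
  apply: realsym_hermsym.
    by apply/is_hermitianmxP; rewrite expr0 scale1r map_mx_id// map_trmx Msym.
  by apply/mxOverP => i j; rewrite mxE; apply/complex_realP; exists (M i j).
have /orthomx_spectralP MCE := hermitian_normalmx Mherm.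
set P := spectralmx MC in MCE; set D := spectral_diag MC in MCE.
have Punit : P \in unitmx := spectral_unit MC.
have Dreal := hermitian_spectral_diag_real Mherm.
have /complex_realP[a Da] : D ord0 ord0 \is Num.real.
  by move/mxOverP: Dreal; apply.
exists a; rewrite -(eigenvalue_map (real_complex R)) -/MC.
apply/eigenvalueP; exists (row 0 P).
  rewrite {1}MCE !mulmxA -row_mul mulmxV// row1 -mulmxA.
  rewrite -rowE row_mul row_diag_mx -scalemxAl -rowE.
  by rewrite Da.
apply/negP => /eqP P0; have /row_freeP[B /(congr1 (row 0))] : row_free P.
  by rewrite row_free_unit.
rewrite row_mul P0 mul0mx row1 => /matrixP/(_ 0 0).
by rewrite !mxE eqxx => /esym/eqP; rewrite oner_eq0.
Qed.

Lemma mul_rowtr_ge0 (R : realDomainType) n (v : 'rV[R]_n) :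
  0 <= (v *m v^T) 0 0.
Proof. by rewrite mxE sumr_ge0// => i _; rewrite mxE -expr2 sqr_ge0. Qed.

Lemma mul_rowtr_eq0 (R : realDomainType) n (v : 'rV[R]_n) :
  (v *m v^T) 0 0 = 0 -> v = 0.
Proof.
rewrite mxE => /eqP; rewrite psumr_eq0 => [|i _]; last first.
  by rewrite mxE -expr2 sqr_ge0.
move=> /allP v0; apply/rowP => i; have := v0 i (mem_index_enum i).
by rewrite !mxE -expr2 sqrf_eq0 => /eqP.
Qed.

(** The reflection that exchanges the unit vectors [v] and [w]. *)
Lemma householder (R : realFieldType) n (v w : 'rV[R]_n) :
  v *m v^T = 1%:M -> w *m w^T = 1%:M ->
  exists Q : 'M[R]_n, [/\ Q^T = Q, Q *m Q = 1%:M & v *m Q = w].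
Proof.
move=> v1 w1; have [->|v_neq_w] := eqVneq v w.
  by exists 1%:M; rewrite trmx1 !mulmx1.
pose u := w - v; pose s := (v *m w^T) 0 0.
have vw : v *m w^T = s%:M by rewrite [LHS]mx11_scalar.
have wv : w *m v^T = s%:M.
  by rewrite -[LHS]trmxK trmx_mul trmxK vw tr_scalar_mx.
have vu : v *m u^T = (s - 1)%:M.
  by rewrite linearB/= mulmxBr vw v1 -raddfB.
have uu : u *m u^T = (2 * (1 - s))%:M.
  rewrite [u^T]linearB/= mulmxBr !mulmxBl w1 vw wv v1 -!raddfB/=.
  by congr (_%:M); ring.
have s1 : 1 - s != 0.
  apply: contra v_neq_w => /eqP s1; rewrite eq_sym -subr_eq0; apply/eqP.
  by apply: mul_rowtr_eq0; rewrite -/u uu s1 mulr0 mxE mul0rn.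
exists (1%:M - (1 - s)^-1 *: (u^T *m u)); split.
- by rewrite linearB/= linearZ/= trmx1 trmx_mul trmxK.
- rewrite mulmxBr mulmx1 mulmxBl mul1mx -scalemxAl -scalemxAr.
  rewrite mulmxA -[_ *m u *m u^T]mulmxA uu mul_mx_scalar -scalemxAl !scalerA.
  have -> : (1 - s)^-1 * ((1 - s)^-1 * (2 * (1 - s))) = (1 - s)^-1 + (1 - s)^-1.
    by field.
  by rewrite scalerDl opprB addrK subrK.
- rewrite mulmxBr mulmx1 -scalemxAr mulmxA vu mul_scalar_mx scalerA.
  have -> : (1 - s)^-1 * (s - 1) = -1 by field.
  by rewrite scaleN1r opprK /u addrC subrK.
Qed.

(** Deflation: a Householder reflection carries the first basis vector to a unit
   eigenvector, which makes the conjugate of [M] block diagonal. *)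
Theorem real_spectral (R : rcfType) n (M : 'M[R]_n) : M^T = M ->
  exists (Q : 'M[R]_n) (e : 'rV[R]_n),
    Q *m Q^T = 1%:M /\ M = Q *m diag_mx e *m Q^T.
Proof.
elim: n M => [|n IHn] M Msym.
  by exists 1%:M, 0; rewrite trmx1 mulmx1; split=> //; rewrite !thinmx0.
have [a /eigenvalueP[v vM v0]] := symmetric_eigenvalue Msym.
pose c := (v *m v^T) 0 0.
have c_gt0 : 0 < c.
  rewrite lt_neqAle mul_rowtr_ge0 andbT eq_sym.
  by apply: contra v0 => /eqP /mul_rowtr_eq0 ->.
pose w := (Num.sqrt c)^-1 *: v.
have w1 : w *m w^T = 1%:M.
  rewrite linearZ/= -scalemxAl -scalemxAr scalerA.
  rewrite [v *m v^T]mx11_scalar -/c scale_scalar_mx -invfM -expr2.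
  by rewrite sqr_sqrtr ?ltW// mulVf ?gt_eqF.
have wM : w *m M = a *: w by rewrite -scalemxAl vM scalerA mulrC -scalerA.
pose e0 : 'rV[R]_(1 + n) := delta_mx 0 0.
have e01 : e0 *m e0^T = 1%:M.
  by rewrite trmx_delta mul_delta_mx; apply/matrixP=> i j; rewrite !ord1 !mxE.
have [Q [Qsym QQ e0Q]] := householder e01 w1.
pose N : 'M[R]_(1 + n) := Q *m M *m Q.
have Nsym : N^T = N by rewrite !trmx_mul Qsym Msym mulmxA.
have wQ : w *m Q = e0 by rewrite -e0Q -mulmxA QQ mulmx1.
have e0N : e0 *m N = a *: e0.
  by rewrite /N !mulmxA e0Q wM -scalemxAl wQ.
have e0E : e0 = row_mx 1%:M 0.
  apply/rowP => j; rewrite !mxE; case: splitP => k jk.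
    by rewrite !mxE ord1 eqxx -(inj_eq val_inj) /= jk ord1.
  by rewrite !mxE eqxx -(inj_eq val_inj) /= jk.
have NE : N = block_mx a%:M 0 0 (drsubmx N).
  have := e0N; rewrite -{1}[N]submxK e0E mul_row_block !mul1mx !mul0mx !addr0.
  rewrite scale_row_mx scaler0 scalemx1 => /eq_row_mx[ulN urN].
  rewrite -{1}[N]submxK ulN urN; congr block_mx.
  by rewrite -[LHS]trmxK trmx_dlsub Nsym urN trmx0.
have N'sym : (drsubmx N)^T = drsubmx N by rewrite trmx_drsub Nsym.
have [Q' [e' [Q'Q' N'E]]] := IHn _ N'sym.
pose B : 'M[R]_(1 + n) := block_mx 1%:M 0 0 Q'.
have BT : B^T = block_mx 1%:M 0 0 Q'^T by rewrite tr_block_mx !trmx0 trmx1.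
exists (Q *m B), (row_mx a%:M e' : 'rV_(1 + n)); split.
  rewrite trmx_mul Qsym -mulmxA (mulmxA B) BT mulmx_block.
  by rewrite !mulmx0 !mul0mx mul1mx !addr0 add0r Q'Q' -scalar_mx_block mul1mx.
have DE : diag_mx (row_mx a%:M e' : 'rV_(1 + n)) =
    block_mx (diag_mx a%:M) 0 0 (diag_mx e') := diag_mx_row _ _.
have NB : N = B *m diag_mx (row_mx a%:M e' : 'rV_(1 + n)) *m B^T.
  rewrite DE BT NE N'E !mulmx_block.
  rewrite !(mulmx0, mul0mx, mul1mx, mulmx1, addr0, add0r).
  by congr block_mx; apply/matrixP => i j; rewrite !ord1 !mxE.
transitivity (Q *m N *m Q).
  by rewrite /N !mulmxA QQ mul1mx -mulmxA QQ mulmx1.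
by rewrite NB trmx_mul Qsym !mulmxA.
Qed.

(** * Quadratic forms, the square root and the largest eigenvalue *)

Section DotProduct.
Variables (R : realType) (n : nat).
Implicit Types (M : 'M[R]_n) (x y z : 'cV[R]_n).

Lemma dotvE x y : dotv x y = \sum_i x i 0 * y i 0.
Proof. by rewrite /dotv mxE; apply: eq_bigr => i _; rewrite mxE. Qed.

Lemma dotvC x y : dotv x y = dotv y x.
Proof. by rewrite !dotvE; apply: eq_bigr => i _; rewrite mulrC. Qed.

Lemma dotvDl x y z : dotv (x + y) z = dotv x z + dotv y z.
Proof. by rewrite /dotv linearD mulmxDl mxE. Qed.

Lemma dotvZl a x z : dotv (a *: x) z = a * dotv x z.
Proof. by rewrite /dotv linearZ -scalemxAl mxE. Qed.

Lemma dotvNl x z : dotv (- x) z = - dotv x z.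
Proof. by rewrite -scaleN1r dotvZl mulN1r. Qed.

Lemma dotvDr x y z : dotv z (x + y) = dotv z x + dotv z y.
Proof. by rewrite dotvC dotvDl !(dotvC z). Qed.

Lemma dotvZr a x z : dotv z (a *: x) = a * dotv z x.
Proof. by rewrite dotvC dotvZl dotvC. Qed.

Lemma dotvNr x z : dotv z (- x) = - dotv z x.
Proof. by rewrite dotvC dotvNl dotvC. Qed.

Lemma dotv_mulmxl M x y : dotv (M *m x) y = dotv x (M^T *m y).
Proof. by rewrite /dotv trmx_mul mulmxA. Qed.

Lemma dotvv_ge0 x : 0 <= dotv x x.
Proof. by rewrite dotvE sumr_ge0// => i _; rewrite -expr2 sqr_ge0. Qed.

Lemma dotvv_gt0 x : x != 0 -> 0 < dotv x x.
Proof.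
move=> x0; rewrite lt_neqAle dotvv_ge0 andbT eq_sym.
apply: contra x0 => /eqP xx; have : x^T = 0.
  by apply: mul_rowtr_eq0; rewrite trmxK.
by move/(congr1 trmx); rewrite trmxK trmx0 => /eqP.
Qed.

Lemma psdmx_normmx_sqr M x : psdmx M -> normmx M x ^+ 2 = qform M x.
Proof. by case=> _ M0; rewrite sqr_sqrtr. Qed.

Lemma pdmx_psdmx M : pdmx M -> psdmx M.
Proof.
case=> Msym M0; split=> // x; have [->|/M0/ltW//] := eqVneq x 0.
by rewrite /qform mulmx0 dotvE sumr_ge0// => i _; rewrite !mxE mulr0.
Qed.

Lemma pdmx_unit M : pdmx M -> M \in unitmx.
Proof.
move=> [Msym M0]; rewrite -row_free_unit -kermx_eq0; apply/rowV0P => v.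
move=> /sub_kermxP vM; apply/eqP; apply: contraT => v0.
have := M0 v^T; rewrite trmx_eq0 v0 /qform /dotv trmxK mulmxA vM mul0mx mxE.
by rewrite ltxx => /(_ isT).
Qed.

Lemma pdmx_inv M : pdmx M -> pdmx (invmx M).
Proof.
move=> Mpd; have Mu := pdmx_unit Mpd; have [Msym M0] := Mpd; split.
  by rewrite trmx_inv Msym.
move=> x x0; have := M0 (invmx M *m x).
rewrite /qform mulmxA mulmxV// mul1mx dotvC; apply.
by apply: contra x0 => /eqP xM; rewrite -[x](mulKVmx Mu) xM mulmx0.
Qed.

Lemma qform_diag (Q : 'M[R]_n) (e : 'rV[R]_n) x :
  qform (Q *m diag_mx e *m Q^T) x = \sum_i e 0 i * (Q^T *m x) i 0 ^+ 2.
Proof.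
rewrite /qform -!mulmxA -[Q in Q *m _]trmxK -dotv_mulmxl dotvE.
apply: eq_bigr => i _; rewrite mul_diag_mx [in X in _ * X]mxE.
by rewrite expr2 mulrCA.
Qed.

(** Replacing the eigenvalues of [M] by their square roots in a spectral
   decomposition shows that the set from which [sqrtmx M] is chosen is not
   empty. *)
Lemma sqrtmxP M : psdmx M -> psdmx (sqrtmx M) /\ sqrtmx M *m sqrtmx M = M.
Proof.
move=> [Msym M0]; rewrite /sqrtmx; case: xgetP => [_ -> //|noS]; exfalso.
have [Q [e [QQ ME]]] := real_spectral Msym; have QQ' := mulmx1C QQ.
have e_ge0 i : 0 <= e 0 i.
  have := M0 (Q *m delta_mx i 0); rewrite ME qform_diag mulmxA QQ' mul1mx.
  rewrite (bigD1 i)//= big1 => [|j ji]; last first.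
    by rewrite mxE (negPf ji) expr0n mulr0.
  by rewrite mxE !eqxx expr1n mulr1 addr0.
apply: (noS (Q *m diag_mx (map_mx Num.sqrt e) *m Q^T)); split.
  split=> [|x]; first by rewrite !trmx_mul trmxK tr_diag_mx mulmxA.
  rewrite qform_diag sumr_ge0// => i _.
  by rewrite mxE mulr_ge0 ?sqrtr_ge0 ?sqr_ge0.
rewrite -!mulmxA (mulmxA Q^T) QQ' mul1mx (mulmxA (diag_mx _)) mulmx_diag ME.
rewrite -!mulmxA; congr (_ *m (diag_mx _ *m _)).
by apply/rowP => i; rewrite !mxE -expr2 sqr_sqrtr.
Qed.

(** In a spectral decomposition the form is a combination of squares weighted by
   eigenvalues, and each of these is below the supremum because the set of all
   eigenvalues is bounded. *)
Lemma qform_le_lambda_max M x : M^T = M ->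
  qform M x <= lambda_max M * dotv x x.
Proof.
move=> Msym; have [Q [e [QQ ME]]] := real_spectral Msym.
have QQ' := mulmx1C QQ.
have dotQ y : dotv y y = \sum_i (Q^T *m y) i 0 ^+ 2.
  rewrite -[y in dotv _ y]mul1mx -QQ -mulmxA -[Q in Q *m _]trmxK -dotv_mulmxl.
  by rewrite dotvE; apply: eq_bigr => i _; rewrite expr2.
have e_eig i : eigenvalue M (e 0 i).
  apply/eigenvalueP; exists (row i Q^T).
    rewrite -row_mul ME !mulmxA QQ' mul1mx row_mul row_diag_mx -scalemxAl.
    by rewrite -rowE.
  apply/negP => /eqP Qi0; have /matrixP/(_ i i) := QQ'.
  move=> /esym; rewrite !mxE eqxx big1 => [/eqP|j _]; first by rewrite oner_eq0.
  by move/rowP/(_ j): Qi0; rewrite !mxE => ->; rewrite mul0r.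
have ub : has_ubound [set a | eigenvalue M a].
  (* An arbitrary eigenvalue is a Rayleigh quotient, so any common bound of the
     weights [e 0 i] bounds it. *)
  exists (\sum_i `|e 0 i|) => a /= /eigenvalueP[v vM v0].
  have vv : 0 < dotv v^T v^T by rewrite dotvv_gt0// trmx_eq0.
  rewrite -(ler_pM2r vv).
  have -> : a * dotv v^T v^T = qform M v^T.
    by rewrite /qform -[in RHS]Msym -trmx_mul vM linearZ/= dotvZr.
  rewrite ME qform_diag dotQ mulr_sumr ler_sum// => i _.
  rewrite ler_wpM2r ?sqr_ge0// (le_trans (ler_norm _))//.
  by rewrite (bigD1 i)//= lerDl sumr_ge0.
rewrite [in leLHS]ME qform_diag dotQ mulr_sumr ler_sum// => i _.
rewrite ler_wpM2r ?sqr_ge0//. apply: ub_le_sup => //; exact: e_eig.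
Qed.

End DotProduct.

Section QuadraticForms.
Variables (R : realType) (n : nat).
Implicit Types (M : 'M[R]_n) (x y : 'cV[R]_n).

Lemma qformZ M a x : qform M (a *: x) = a ^+ 2 * qform M x.
Proof. by rewrite /qform -scalemxAr dotvZl dotvZr mulrA expr2. Qed.

Lemma qformN M x : qform M (- x) = qform M x.
Proof. by rewrite -scaleN1r qformZ sqrrN expr1n mul1r. Qed.

Lemma qformD M x y : M^T = M ->
  qform M (x + y) = qform M x + 2 * dotv x (M *m y) + qform M y.
Proof.
move=> Msym; rewrite /qform mulmxDr !dotvDl !dotvDr.
rewrite (dotvC y (M *m x)) dotv_mulmxl Msym; ring.
Qed.

Lemma qform_convex M (t : R) x y : psdmx M -> 0 <= t -> t <= 1 ->
  qform M ((1 - t) *: x + t *: y) <= (1 - t) * qform M x + t * qform M y.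
Proof.
move=> [Msym M0] t0 t1.
have := M0 (x - y); rewrite qformD// mulmxN dotvNr qformN => D0.
rewrite qformD// !qformZ -scalemxAr dotvZl dotvZr.
have tt : 0 <= t * (1 - t) by rewrite mulr_ge0// subr_ge0.
have := mulr_ge0 tt D0; lra.
Qed.

Lemma continuous_qform M : continuous (qform M).
Proof.
rewrite (_ : qform M = fun y => \sum_i \sum_j y i 0 * (M i j * y j 0)).
  apply: continuous_big => [|i _]; first exact: add_continuous.
  apply: continuous_big => [|j _] x; first exact: add_continuous.
  apply: (@continuousM _ _ (fun y => y i 0) (fun y => M i j * y j 0)).
    exact: coord_continuous.
  apply: (@continuousM _ _ (fun=> M i j) (fun y => y j 0)).
    exact: cst_continuous.
  exact: coord_continuous.
apply/funext => y; rewrite /qform dotvE; apply: eq_bigr => i _.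
by rewrite mxE mulr_sumr.
Qed.

End QuadraticForms.

(** * Borel measurability of vector-valued and matrix-valued maps *)

Local Notation borel_rect R m n := (g_sigma_algebraType (@open 'M[R]_(m, n))).

Section Borel.
Variable R : realType.

(** Balls of rational centre and radius form a countable basis, and in the
   maximum norm each of them is an intersection of finitely many conditions on
   single entries. *)
Lemma measurable_entries_borel d (T : measurableType d) m n
    (Y : T -> 'M[R]_(m, n)) :
  (forall i j, measurable_fun [set: T] (fun w => Y w i j)) ->
  measurable_fun [set: T]
    (Y : T -> borel_rect R m n).
Proof.
move=> mY.
apply: (@measurability _ _ T (borel_rect R m n) setT Y
  (@open 'M[R]_(m, n)) erefl).
move=> _ [U oU <-]; rewrite setTI.
pose C (p : 'M[rat]_(m, n) * rat) : 'M[R]_(m, n) := map_mx ratr p.1.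
pose B p : set 'M[R]_(m, n) := ball (C p) (ratr p.2).
pose F p : set T :=
  if `[< 0 < ratr p.2 :> R /\ B p `<=` U >] then Y @^-1` B p else set0.
have -> : Y @^-1` U = \bigcup_p F p.
  apply/seteqP; split=> [w Uw|w [p _]]; last first.
    by rewrite /F; case: asboolP => // -[_ BU] /BU.
  have /nbhs_ballP[e /= e0 eU] := open_nbhs_nbhs (conj oU Uw).
  have e20 : 0 < e / 2 by rewrite divr_gt0.
  have [r /[!in_itv]/= /andP[r0 re]] := rat_in_itvoo e20.
  have near_rat i j : exists q : rat, `|ratr q - Y w i j| < ratr r.
    have : Y w i j - ratr r < Y w i j + ratr r by rewrite ltrD2l gtrN.
    by move=> /rat_in_itvoo[q /[!in_itv]/= qE]; exists q; rewrite ltr_distl.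
  pose c : 'M[rat]_(m, n) := \matrix_(i, j) xchoose (near_rat i j).
  have cP i j : `|ratr (c i j) - Y w i j| < ratr r.
    by rewrite mxE; exact: (xchooseP (near_rat i j)).
  exists (c, r) => //; rewrite /F; case: asboolP => [_|[]].
    by split=> // i j; rewrite /ball/= mxE.
  split=> // v [_ Bv]; apply: eU; split=> // i j; rewrite /ball/=.
  have := Bv i j; rewrite /ball/= mxE => Bij.
  rewrite (splitr e) (le_lt_trans (ler_distD (ratr (c i j)) _ _))//.
  by rewrite ltrD// (lt_trans _ re)// distrC.
apply: countable_bigcupT_measurable => [|p]; first exact: countableP.
rewrite /F; case: asboolP => // -[r0 _].
have -> : Y @^-1` B p =
    \bigcap_(ij in [set: 'I_m * 'I_n])
      (fun w => Y w ij.1 ij.2) @^-1` ball (C p ij.1 ij.2) (ratr p.2).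
  apply/seteqP; split=> [w [_ Bw] [i j] _|w Bw]; first exact: Bw.
  by split=> // i j; exact: (Bw (i, j)).
apply: fin_bigcap_measurable => // -[i j] _; rewrite -[X in measurable X]setTI.
by apply: mY => //; apply: open_measurable; exact: ball_open.
Qed.

Lemma continuous_borel_measurable (S : ptopologicalType) (f : S -> R) :
  continuous f ->
  measurable_fun [set: g_sigma_algebraType (@open S)]
    (f : g_sigma_algebraType (@open S) -> R).
Proof.
move=> /continuousP cf; apply: (measurability _ (RGenOpens.measurableE R)).
move=> _ [_ [a [b ->] <-]]; rewrite setTI; apply: sub_sigma_algebra.
exact/cf/interval_open.
Qed.

Lemma borel_mx_entry_measurable m n i j :
  measurable_fun [set: borel_rect R m n]
    (fun M : borel_rect R m n =>
       (M : 'M[R]_(m, n)) i j).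
Proof.
apply: (@continuous_borel_measurable 'M[R]_(m, n)).
exact: (@coord_continuous _ m n i j).
Qed.

Lemma measurable_entry d (T : measurableType d) m n
    (Y : T -> borel_rect R m n) i j :
  measurable_fun [set: T] Y ->
  measurable_fun [set: T] (fun w => (Y w : 'M[R]_(m, n)) i j).
Proof. exact: measurableT_comp (borel_mx_entry_measurable i j). Qed.

End Borel.

Section BorelMatrixOperations.
Context {R : realType} {d : measure_display} {T : measurableType d}.

Lemma measurable_addmx m n (Y Z : T -> borel_rect R m n) :
  measurable_fun [set: T] Y -> measurable_fun [set: T] Z ->
  measurable_fun [set: T]
    ((fun w => (Y w : 'M[R]_(m, n)) + (Z w : 'M[R]_(m, n)))
       : T -> borel_rect R m n).
Proof.
move=> mY mZ; apply: measurable_entries_borel => i j.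
under eq_fun do rewrite mxE.
by apply: measurable_funD; exact: measurable_entry.
Qed.

Lemma measurable_scalemx a m n (Y : T -> borel_rect R m n) :
  measurable_fun [set: T] Y ->
  measurable_fun [set: T]
    ((fun w => a *: (Y w : 'M[R]_(m, n))) : T -> borel_rect R m n).
Proof.
move=> mY; apply: measurable_entries_borel => i j.
under eq_fun do rewrite mxE.
by apply: measurable_funM => //; exact: measurable_entry.
Qed.

Lemma measurable_oppmx m n (Y : T -> borel_rect R m n) :
  measurable_fun [set: T] Y ->
  measurable_fun [set: T]
    ((fun w => - (Y w : 'M[R]_(m, n))) : T -> borel_rect R m n).
Proof.
by move=> mY; under eq_fun do rewrite -scaleN1r; exact: measurable_scalemx.
Qed.

Lemma measurable_mulmx m n p
    (Y : T -> borel_rect R m n) (Z : T -> borel_rect R n p) :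
  measurable_fun [set: T] Y -> measurable_fun [set: T] Z ->
  measurable_fun [set: T]
    ((fun w => (Y w : 'M[R]_(m, n)) *m (Z w : 'M[R]_(n, p)))
       : T -> borel_rect R m p).
Proof.
move=> mY mZ; apply: measurable_entries_borel => i j.
under eq_fun do rewrite mxE.
by apply: measurable_sum => k; apply: measurable_funM; exact: measurable_entry.
Qed.

End BorelMatrixOperations.

(** * Recursions driven by independent noise *)

Section MarkovChain.
Context {R : realType} {d0 : measure_display} {Omega : measurableType d0}
  (Q : probability Omega R).
Context {d1 : measure_display} {S : measurableType d1}
  {d2 : measure_display} {E : measurableType d2}.
Variable X : nat -> {RV Q >-> E}.
Hypothesis Xindep : mutually_independent X.
Variables (phi : S * E -> S) (s0 : S) (s : nat -> Omega -> S).
Hypothesis mphi : measurable_fun [set: S * E] phi.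
Hypothesis s_init : forall w, s 0%N w = s0.
Hypothesis s_step : forall k w, s k.+1 w = phi (s k w, X k w).

Lemma measurable_state k : measurable_fun [set: Omega] (s k).
Proof.
elim: k => [|k IHk].
  by rewrite (_ : s 0%N = cst s0)//; apply/funext => w; exact: s_init.
rewrite (_ : s k.+1 = phi \o (fun w => (s k w, X k w))); last first.
  by apply/funext => w; exact: s_step.
by apply: measurableT_comp => //; exact: measurable_fun_pair.
Qed.

Let mstate_mixin k := isMeasurableFun.Build _ _ _ _ _ (measurable_state k).
Let mstate k : {mfun Omega >-> S} := HB.pack (s k) (mstate_mixin k).

Let measurable_joint k :
  measurable_fun [set: Omega] (fun w => (s k w, X k w)).
Proof. by apply: measurable_fun_pair => //; exact: measurable_state. Qed.

Let mjoint_mixin k := isMeasurableFun.Build _ _ _ _ _ (measurable_joint k).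
Let mjoint k : {mfun Omega >-> (S * E)%type} :=
  HB.pack (fun w => (s k w, X k w)) (mjoint_mixin k).

Let future (J : {fset nat}) (B : nat -> set E) :=
  \bigcap_(j in [set` J]) (X j @^-1` B j).

Let measurable_future J B : (forall j, measurable (B j)) ->
  measurable (future J B).
Proof.
move=> mB; apply: fin_bigcap_measurable => [|j _].
  exact: finite_fset.
by rewrite -[X in measurable X]setTI; exact: measurable_funP.
Qed.

(** By induction on [k]: on rectangles, the pair of the state and the next noise
   variable is independent of the later noise variables, and two finite measures
   that agree on rectangles agree on the product, in particular on preimages
   under [phi]. *)
Lemma state_indep_future k (A : set S) (J : {fset nat}) (B : nat -> set E) :
  measurable A -> (forall j, measurable (B j)) ->
  (forall j, j \in J -> (k <= j)%N) ->
  Q (s k @^-1` A `&` future J B) = (Q (s k @^-1` A) * Q (future J B))%E.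
Proof.
elim: k A J B => [|k IHk] A J B mA mB kJ.
  have [As|As] := pselect (A s0).
    have -> : s 0%N @^-1` A = setT.
      by apply/seteqP; split=> // w _; rewrite /preimage/= s_init.
    by rewrite setTI probability_setT mul1e.
  have -> : s 0%N @^-1` A = set0.
    by apply/seteqP; split=> // w; rewrite /preimage/= s_init.
  by rewrite set0I measure0 mul0e.
have mF := measurable_future J mB; set F := future J B in mF *.
have @m1 : {measure set (S * E) -> \bar R}.
  refine (pushforward (mrestr Q mF) (mjoint k) : {measure set _ -> \bar R}).
  exact: measurable_joint.
have QF0 : 0 <= fine (Q F) by rewrite fine_ge0.
pose m2 : {measure set (S * E) -> \bar R} :=
  mscale (NngNum QF0) (distribution Q (mjoint k)).
suff m12 W : measurable W -> m1 W = m2 W.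
  have -> : s k.+1 @^-1` A = mjoint k @^-1` (phi @^-1` A).
    by apply/seteqP; split=> w; rewrite /preimage/= s_step.
  have mW : measurable (phi @^-1` A).
    by rewrite -[X in measurable X]setTI; exact: mphi.
  have := m12 _ mW; rewrite /m1 /= /pushforward /mrestr => ->.
  by rewrite /m2 /= /mscale /= muleC fineK// fin_num_measure.
pose G : set (set (S * E)) := [set C | exists A', measurable A' /\
  exists B', measurable B' /\ C = A' `*` B'].
apply: (measure_unique G (fun=> setT)) => //.
- rewrite measurable_prod_measurableType //; congr (<<s _ >>).
  rewrite predeqE; split => [[A' mA' [B' mB' <-]]|[A' [mA' [B' [mB' ->]]]]].
    by exists A'; split => //; exists B'.
  by exists A' => //; exists B'.
- move=> _ _ [X1 [mX1 [X2 [mX2 ->]]]] [Y1 [mY1 [Y2 [mY2 ->]]]].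
  rewrite -setXI; exists (X1 `&` Y1); split; first exact: measurableI.
  by exists (X2 `&` Y2); split => //; exact: measurableI.
- move=> _; exists setT; split=> //; exists setT; split=> //.
  by rewrite setXTT.
- by apply/seteqP; split=> // x _; exists 0%N.
- move=> _ [A' [mA' [B' [mB' ->]]]].
  pose BJ j := if j == k then B' else B j.
  have mBJ j : measurable (BJ j) by rewrite /BJ; case: ifP.
  have kNJ : k \notin J by apply/negP => /kJ; rewrite ltnn.
  have BJE j : j \in J -> BJ j = B j.
    by rewrite /BJ; case: eqP => // -> kJ'; rewrite kJ' in kNJ.
  have futk : future [fset k]%fset BJ = X k @^-1` B'.
    rewrite /future set_fset1 bigcap_set1.
    by rewrite /BJ eqxx.
  have futkJ : future (k |` J)%fset BJ = X k @^-1` B' `&` F.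
    rewrite /future set_fsetU set_fset1 bigcap_setU bigcap_set1.
    rewrite {1}/BJ eqxx; congr (_ `&` _).
    by apply: eq_bigcapr => j /= /BJE ->.
  have QkJ : Q (future (k |` J)%fset BJ) = (Q (X k @^-1` B') * Q F)%E.
    rewrite /future Xindep// big_fsetU1//= /BJ eqxx; congr (_ * _)%E.
    rewrite /F /future Xindep// !big_seq; apply: eq_bigr => j jJ.
    by move: (BJE j jJ); rewrite /BJ => ->.
  have kkJ j : j \in (k |` J)%fset -> (k <= j)%N.
    by rewrite !inE => /orP[/eqP-> //|/kJ /ltnW].
  have kk j : j \in [fset k]%fset -> (k <= j)%N by rewrite inE => /eqP ->.
  have rect : mjoint k @^-1` (A' `*` B') = s k @^-1` A' `&` X k @^-1` B'.
    by apply/seteqP; split=> w [].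
  have -> : m1 (A' `*` B') = Q (s k @^-1` A' `&` X k @^-1` B' `&` F).
    by rewrite -rect.
  have -> : m2 (A' `*` B') =
      ((fine (Q F))%:E * Q (s k @^-1` A' `&` X k @^-1` B'))%E by rewrite -rect.
  rewrite -setIA -futkJ IHk// QkJ -futk IHk// futk.
  by rewrite fineK ?fin_num_measure// [RHS]muleC muleA.
- move=> _; rewrite /m1 /= /pushforward /mrestr.
  apply: (@le_lt_trans _ _ 1%E); last exact: ltry.
  apply: probability_le1; apply: measurableI => //.
  by rewrite preimage_setT.
Qed.

(** The joint law of the state and the next noise variable is the product of
   their laws, so Tonelli's theorem applies. *)
Lemma integral_state_step k (v : S -> \bar R) :
  measurable_fun [set: S] v -> (forall x, 0 <= v x)%E ->
  (\int[Q]_w v (s k.+1 w) =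
   \int[Q]_w \int[distribution Q (X k)]_e v (phi (s k w, e)))%E.
Proof.
move=> mv v0.
have mvphi : measurable_fun [set: S * E] (v \o phi) by exact: measurableT_comp.
have -> : (\int[Q]_w v (s k.+1 w) =
    \int[distribution Q (mjoint k)]_p (v \o phi) p)%E.
  rewrite ge0_integral_distribution//; last by move=> p; exact: v0.
  by apply: eq_integral => w _ /=; rewrite s_step.
have law W : measurable W ->
    (distribution Q (mstate k) \x distribution Q (X k))%E W =
    distribution Q (mjoint k) W.
  apply: product_measure_unique => A B mA mB /=.
  have futk : future [fset k]%fset (fun=> B) = X k @^-1` B.
    by rewrite /future set_fset1 bigcap_set1.
  have rect : mjoint k @^-1` (A `*` B) = s k @^-1` A `&` X k @^-1` B.
    by apply/seteqP; split=> w [].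
  transitivity (Q (s k @^-1` A `&` X k @^-1` B)); first by rewrite -rect.
  rewrite -futk state_indep_future ?futk//.
  move=> j; rewrite inE => /eqP ->. exact: leqnn.
rewrite -(eq_measure_integral _ (fun W mW _ => law W mW)).
rewrite fubini_tonelli1//; last by move=> p; exact: v0.
rewrite ge0_integral_distribution//. 
  by apply: measurable_fun_fubini_tonelli_F => // p; exact: v0.
by move=> x; apply: integral_ge0 => e _; exact: v0.
Qed.

Lemma markov_contraction (v : S -> \bar R) (c : R) :
  measurable_fun [set: S] v -> (forall x, 0 <= v x)%E -> 0 <= c ->
  (forall k x, \int[distribution Q (X k)]_e v (phi (x, e)) <= c%:E * v x)%E ->
  forall k, (\int[Q]_w v (s k w) <= (c ^+ k)%:E * v s0)%E.
Proof.
move=> mv v0 c0 contr; elim=> [|k IHk].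
  rewrite (eq_integral (cst (v s0))) => [|w _]; last by rewrite s_init.
  by rewrite integral_cst//= probability_setT mule1 mul1e.
rewrite integral_state_step// exprS EFinM -muleA.
apply: (@le_trans _ _ (\int[Q]_w (c%:E * v (s k w)))%E).
  apply: ge0_le_integral => //.
  - by move=> w _; apply: integral_ge0 => e _; exact: v0.
  - apply: (@measurableT_comp _ _ _ _ _ _
      (fubini_F (distribution Q (X k)) (v \o phi))).
      2: exact: measurable_state.
    apply: measurable_fun_fubini_tonelli_F => [|p]; last exact: v0.
    exact: measurableT_comp.
  - apply: emeasurable_funM => //; apply: measurableT_comp => //.
    exact: measurable_state.
have mvs : measurable_fun [set: Omega] (fun w => v (s k w)).
  by apply: measurableT_comp => //; exact: measurable_state.
rewrite ge0_integralZl//.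
by rewrite lee_wpmul2l.
Qed.

End MarkovChain.

(** * Strongly convex functions with Lipschitz gradient *)

Lemma sqr_modulus_continuous (R : realType) (T : topologicalType)
    (h : T -> R) (q : T -> T -> R) :
  (forall x, continuous (q x)) -> (forall x, q x x = 0) ->
  (forall x y, (h y - h x) ^+ 2 <= q x y) -> continuous h.
Proof.
move=> cq q0 hq x; apply/cvgrPdist_lt => e e0.
have := cq x x => /cvgrPdist_lt /(_ (e ^+ 2)).
rewrite exprn_gt0// q0 => /(_ isT); apply: filterS => y.
rewrite sub0r normrN => qe; rewrite distrC.
rewrite -(@ltr_pXn2r _ 2) ?nnegrE//; last exact: ltW.
rewrite (le_lt_trans _ qe)// real_normK ?num_real//.
exact: le_trans (ler_norm _).
Qed.

Section Gradient.
Variables (R : realType) (n : nat) (G : 'M[R]_n) (f : 'cV[R]_n -> R) (mu : R).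
Hypotheses (G_pd : pdmx G) (mu_gt0 : 0 < mu).
Hypothesis f_sc : strongly_convex f mu (invmx G).
Hypothesis f_lip : lipschitz_gradient f 1 (invmx G).

Let Gi_psd : psdmx (invmx G) := pdmx_psdmx (pdmx_inv G_pd).

Lemma strongly_convexP x y :
  f x + dotv (grad f x) (y - x) + mu / 2 * qform (invmx G) (y - x) <= f y.
Proof. by rewrite -psdmx_normmx_sqr//; exact: f_sc. Qed.

Lemma lipschitz_gradientP x y :
  f y <= f x + dotv (grad f x) (y - x) + 1 / 2 * qform (invmx G) (y - x).
Proof. by rewrite -psdmx_normmx_sqr//; exact: f_lip. Qed.

Lemma strongly_convex_tangent x y : f x + dotv (grad f x) (y - x) <= f y.
Proof.
apply: le_trans (strongly_convexP x y); rewrite lerDl.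
by have [_ q_ge0] := Gi_psd; rewrite mulr_ge0 ?q_ge0// divr_ge0// ltW.
Qed.

Lemma qform_inv d : qform (invmx G) (G *m d) = qform G d.
Proof. by rewrite /qform mulKmx ?pdmx_unit// dotvC. Qed.

Lemma strong_convexity_le1 : (0 < n)%N -> mu <= 1.
Proof.
move=> n_gt0; pose e : 'cV[R]_n := delta_mx (Ordinal n_gt0) 0.
have e0 : e != 0.
  apply/eqP => /matrixP/(_ (Ordinal n_gt0) 0)/eqP.
  by rewrite !mxE !eqxx oner_eq0.
have q0 : 0 < qform (invmx G) e by case: (pdmx_inv G_pd) => _; apply.
have := le_trans (strongly_convexP 0 e) (lipschitz_gradientP 0 e).
by rewrite subr0 lerD2l ler_pM2r// ler_pM2r ?invr_gt0.
Qed.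

(** Compare the tangent plane of [f] at [x] with the upper quadratic model of
   [f] at [y], both taken at the minimiser [y - G (grad f y - grad f x)] of
   their difference; the upper model at [x] bounds what is left. *)
Lemma gradient_lipschitz x y :
  qform G (grad f y - grad f x) <= qform (invmx G) (y - x).
Proof.
set d := grad f y - grad f x; pose t := G *m d.
have := le_trans (strongly_convex_tangent x (y - t))
  (lipschitz_gradientP y (y - t)).
have := lipschitz_gradientP x y.
have -> : y - t - y = - t by rewrite addrAC subrr add0r.
have -> : y - t - x = (y - x) - t by rewrite addrAC.
rewrite qformN qform_inv !dotvDr !dotvNr.
have qd : qform G d = dotv (grad f y) t - dotv (grad f x) t.
  by rewrite /qform dotvDl dotvNl.
by move: qd; lra.
Qed.

(** The vector [G^1/2 grad f] is continuous, because [gradient_lipschitz] bounds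
   the square of each of its increments; the gradient is a linear image of it. *)
Lemma measurable_grad i :
  measurable_fun [set: g_sigma_algebraType (@open 'cV[R]_n)]
    (fun x : g_sigma_algebraType (@open 'cV[R]_n) => grad f (x : 'cV[R]_n) i 0).
Proof.
have [[Ssym _] SS] := sqrtmxP (pdmx_psdmx G_pd); set S := sqrtmx G in Ssym SS.
have cSg k : continuous (fun x => (S *m grad f x) k 0).
  apply: (@sqr_modulus_continuous R 'cV[R]_n _
    (fun x y => qform (invmx G) (y - x))).
  - move=> x y; apply: (@continuous_comp 'cV[R]_n 'cV[R]_n R
      (fun y => y - x) (qform (invmx G)) y).
      apply: (@continuousB _ _ 'cV[R]_n id (cst x)) => //.
      exact: cst_continuous.
    exact: continuous_qform.
  - move=> x; rewrite subrr /qform mulmx0 dotvE big1// => l _.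
    by rewrite !mxE mulr0.
  move=> x y; apply: le_trans (gradient_lipschitz x y).
  set d := grad f y - grad f x.
  have -> : (S *m grad f y) k 0 - (S *m grad f x) k 0 = (S *m d) k 0.
    by rewrite mulmxBr !mxE.
  have -> : qform G d = dotv (S *m d) (S *m d).
    by rewrite dotv_mulmxl Ssym mulmxA SS.
  rewrite dotvE (bigD1 k)//= -expr2 lerDl sumr_ge0// => l _.
  by rewrite -expr2 sqr_ge0.
have Su : S \in unitmx.
  by have := pdmx_unit G_pd; rewrite -SS unitmx_mul => /andP[].
rewrite (_ : (fun _ => _) = fun x => \sum_k invmx S i k * (S *m grad f x) k 0).
  apply: measurable_sum => k; apply: measurable_funM => //.
  exact: (@continuous_borel_measurable _ 'cV[R]_n).
by apply/funext => x; rewrite -{1}[grad f x](mulKmx Su) mxE.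
Qed.

(** The part of the one-step estimate in which no randomness is left. The
   extrapolation rule turns [t u] into [(1 - t) (x - y) + t (x - xstar)], so the
   inner product with the gradient is a combination of two linearisations of [f]
   at [x], one towards [y] and one towards [xstar]. The strong convexity gained
   in the second cancels the term [t |x - xstar|^2] lost by convexity of the
   squared norm. *)
Lemma accelerated_estimate (t : R) x y z xstar u : 0 <= t -> t <= 1 ->
  (1 + t) *: x = y + t *: z ->
  u = (1 - t) *: (z - xstar) + t *: (x - xstar) ->
  f x - f xstar + mu / 2 * qform (invmx G) u - t * dotv u (grad f x) <=
  (1 - t) * (f y - f xstar + mu / 2 * qform (invmx G) (z - xstar)).
Proof.
move=> t0 t1 xE uE.
have tu : t *: u = (1 - t) *: (x - y) + t *: (x - xstar).
  have -> : y = (1 + t) *: x - t *: z by rewrite xE addrK.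
  rewrite uE; apply/matrixP => i j; rewrite !mxE; ring.
have tug : t * dotv u (grad f x) =
    - (1 - t) * dotv (grad f x) (y - x) - t * dotv (grad f x) (xstar - x).
  rewrite -dotvZl tu dotvDl !dotvZl !(dotvC _ (grad f x)).
  rewrite -(opprB y x) -(opprB xstar x) !dotvNr; ring.
have qu : qform (invmx G) u <= (1 - t) * qform (invmx G) (z - xstar) +
    t * qform (invmx G) (x - xstar) by rewrite uE qform_convex.
have := strongly_convexP x xstar.
rewrite -[in qform _ _](opprB x xstar) qformN.
move=> /(ler_wpM2l t0) h1.
have t1' : 0 <= 1 - t by rewrite subr_ge0.
have h2 := ler_wpM2l t1' (strongly_convex_tangent x y).
have mu2 : 0 <= mu / 2 by rewrite divr_ge0 ?ltW.
have h3 := ler_wpM2l mu2 qu.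
rewrite tug; move: h1 h2 h3; nra.
Qed.

End Gradient.

(** * Means of random matrices *)

Section MatrixMean.
Context {R : realType} {d : measure_display} {T : measurableType d}.
Variables (P : probability T R) (n : nat) (X : T -> 'M[R]_n).
Hypothesis X_int : integrable_mx P X.

Let dotv_entries (M : 'M[R]_n) a b :
  dotv a (M *m b) =
  \sum_(p : 'I_n * 'I_n) a p.1 0 * b p.2 0 * M p.1 p.2.
Proof.
rewrite dotvE -(pair_bigA _ (fun i j => a i 0 * b j 0 * M i j))/=.
apply: eq_bigr => i _; rewrite mxE mulr_sumr; apply: eq_bigr => j _.
by rewrite -mulrA (mulrC (b j 0)).
Qed.

Lemma integrable_dotv a b :
  P.-integrable [set: T] (fun w => (dotv a (X w *m b))%:E).
Proof.
under eq_fun do rewrite dotv_entries -sumEFin.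
apply: integrable_sum => //= p _.
under eq_fun do rewrite EFinM.
exact: integrableZl.
Qed.

Lemma integral_dotv a b :
  (\int[P]_w (dotv a (X w *m b))%:E = (dotv a (mean_mx P X *m b))%:E)%E.
Proof.
under eq_integral do rewrite dotv_entries -sumEFin.
rewrite integral_sum//= => [|p]; last first.
  under eq_fun do rewrite EFinM.
  exact: integrableZl.
rewrite dotv_entries -sumEFin; apply: eq_bigr => p _.
under eq_integral do rewrite EFinM.
rewrite integralZl// [RHS]EFinM mxE unlock fineK//.
exact: integrable_fin_num.
Qed.

Lemma mean_mx_symmetric : (forall w, (X w)^T = X w) ->
  (mean_mx P X)^T = mean_mx P X.
Proof.
move=> Xsym; apply/matrixP => i j; rewrite !mxE.
by congr (fine 'E_P[_]); apply/funext => w; rewrite -[in RHS]Xsym mxE.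
Qed.

End MatrixMean.

Section NormalisedSecondMoment.
Context {R : realType} {d : measure_display} {T : measurableType d}.
Variables (P : probability T R) (n : nat) (H : T -> 'M[R]_n).
Hypotheses (H_psd : forall w, psdmx (H w)) (H_int : integrable_mx P H).
Let G := mean_mx P H.
Hypothesis G_pd : pdmx G.
Let S := sqrtmx G.
Let K := invmx S.
Let A w := K *m H w *m K.
Hypothesis A2_int : integrable_mx P (fun w => A w ^+ 2).
Let M2 := mean_mx P (fun w => A w ^+ 2).

Let S_sym : S^T = S. Proof. by have [[]] := sqrtmxP (pdmx_psdmx G_pd). Qed.

Let SS : S *m S = G. Proof. by have [] := sqrtmxP (pdmx_psdmx G_pd). Qed.

Let S_unit : S \in unitmx.
Proof. by have := pdmx_unit G_pd; rewrite -SS unitmx_mul => /andP[]. Qed.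

Let K_sym : K^T = K. Proof. by rewrite /K trmx_inv S_sym. Qed.

Let KK : K *m K = invmx G.
Proof.
have G_unit := pdmx_unit G_pd.
apply: (can_inj (mulKmx G_unit)); rewrite mulmxV// -SS.
by rewrite -mulmxA (mulmxA S K) mulmxV// mul1mx mulmxV.
Qed.

Let A_sym w : (A w)^T = A w.
Proof.
by case: (H_psd w) => Hsym _; rewrite /A !trmx_mul K_sym Hsym mulmxA.
Qed.

Let qform_sqr w v : qform (A w ^+ 2) v = dotv (A w *m v) (A w *m v).
Proof. by rewrite /qform expr2 -mulmxE -mulmxA dotv_mulmxl A_sym. Qed.

Lemma qform_inv_step w g :
  qform (invmx G) (H w *m g) = qform (A w ^+ 2) (S *m g).
Proof.
rewrite qform_sqr /A -!mulmxA mulKmx// -KK /qform -mulmxA.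
by rewrite [RHS]dotv_mulmxl K_sym.
Qed.

Let M2_sym : M2^T = M2.
Proof.
by apply: mean_mx_symmetric => w; rewrite expr2 -mulmxE trmx_mul A_sym.
Qed.

(** The second moment dominates the square of the mean, which is the identity:
   expand the mean of the squared norm of [A v - v]. *)
Lemma second_moment_ge v : dotv v v <= qform M2 v.
Proof.
pose B w :=
  qform (A w ^+ 2) v + (- 2) * dotv (K *m v) (H w *m (K *m v)) + dotv v v.
have B0 w : 0 <= B w.
  have -> : B w = dotv (A w *m v - v) (A w *m v - v).
    rewrite /B qform_sqr !(dotvDl, dotvDr, dotvNl, dotvNr).
    have -> : dotv (K *m v) (H w *m (K *m v)) = dotv v (A w *m v).
      by rewrite dotv_mulmxl K_sym /A !mulmxA.
    by rewrite (dotvC (A w *m v) v); ring.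
  exact: dotvv_ge0.
have intB : (\int[P]_w (B w)%:E =
    (qform M2 v + (- 2) * dotv v v + dotv v v)%:E)%E.
  under eq_integral do rewrite /B !EFinD EFinM.
  have i1 := integrable_dotv A2_int v v.
  have i2 := integrable_dotv H_int (K *m v) (K *m v).
  rewrite integralD//=; last 2 first.
  - by apply: integrableD => //; exact: integrableZl.
  - by apply: finite_measure_integrable_cst.
  rewrite integralD//=; last exact: integrableZl.
  rewrite integralZl// integral_dotv// integral_dotv//.
  rewrite integral_cst//= probability_setT mule1 -EFinM -!EFinD.
  congr (_ + _ * _ + _)%:E.
  by rewrite -/G dotv_mulmxl K_sym -SS -!mulmxA mulKVmx// mulKmx.
have : (0 <= \int[P]_w (B w)%:E)%E.
  by apply: integral_ge0 => w _; rewrite lee_fin.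
by rewrite intB lee_fin; lra.
Qed.

Lemma second_moment_le g :
  qform M2 (S *m g) <= lambda_max M2 * qform G g.
Proof.
have -> : qform G g = dotv (S *m g) (S *m g).
  by rewrite dotv_mulmxl S_sym mulmxA SS.
exact: qform_le_lambda_max.
Qed.

Lemma lambda_max_ge1 : (0 < n)%N -> 1 <= lambda_max M2.
Proof.
move=> n_gt0; pose e : 'cV[R]_n := delta_mx (Ordinal n_gt0) 0.
have e0 : 0 < dotv e e.
  apply: dotvv_gt0; apply/eqP => /matrixP/(_ (Ordinal n_gt0) 0)/eqP.
  by rewrite !mxE !eqxx oner_eq0.
have := le_trans (second_moment_ge e) (qform_le_lambda_max e M2_sym).
by rewrite -{1}[dotv e e]mul1r ler_pM2r.
Qed.

End NormalisedSecondMoment.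

(** * The accelerated method *)

Section Update.
Context {R : realType} {n : nat}.
Variables (f : 'cV[R]_n -> R) (mu tau : R) (Gi : 'M[R]_n) (xstar : 'cV[R]_n).

Definition update (p : (borel_rect R n 1 * borel_rect R n 1) * borel_mx R n) :
    borel_rect R n 1 * borel_rect R n 1 :=
  let z : 'cV[R]_n := p.1.2 in
  let x : 'cV[R]_n :=
    (1 / (1 + tau)) *: (p.1.1 : 'cV[R]_n) + (tau / (1 + tau)) *: z in
  let h : 'cV[R]_n := (p.2 : 'M[R]_n) *m grad f x in
  (x - h, z + tau *: (x - z) - (tau / mu) *: h).

Definition potential (s : borel_rect R n 1 * borel_rect R n 1) : R :=
  f s.1 - f xstar + mu / 2 * normmx Gi ((s.2 : 'cV[R]_n) - xstar) ^+ 2.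

Lemma measurable_update :
  (forall i, measurable_fun [set: borel_rect R n 1]
    (fun x : borel_rect R n 1 => grad f (x : 'cV[R]_n) i 0)) ->
  measurable_fun
    [set: (borel_rect R n 1 * borel_rect R n 1) * borel_mx R n] update.
Proof.
move=> mg.
pose Sp : measurableType _ :=
  ((borel_rect R n 1 * borel_rect R n 1) * borel_mx R n)%type.
have mgrad (Y : Sp -> borel_rect R n 1) : measurable_fun [set: Sp] Y ->
    measurable_fun [set: Sp]
      ((fun p => grad f (Y p : 'cV[R]_n)) : Sp -> borel_rect R n 1).
  move=> mY; apply: measurable_entries_borel => i j; rewrite ord1.
  exact: measurableT_comp (mg i) mY.
have my : measurable_fun [set: Sp] (fun p : Sp => p.1.1).
  by apply: measurableT_comp => //; exact: measurable_fst.
have mz : measurable_fun [set: Sp] (fun p : Sp => p.1.2).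
  by apply: measurableT_comp => //; exact: measurable_fst.
have mh : measurable_fun [set: Sp] (fun p : Sp => p.2) by exact: measurable_snd.
have mx := measurable_addmx (measurable_scalemx (1 / (1 + tau)) my)
  (measurable_scalemx (tau / (1 + tau)) mz).
have mhg := measurable_mulmx mh (mgrad _ mx).
have my' := measurable_addmx mx (measurable_oppmx mhg).
have mz' := measurable_addmx
  (measurable_addmx mz
     (measurable_scalemx tau (measurable_addmx mx (measurable_oppmx mz))))
  (measurable_oppmx (measurable_scalemx (tau / mu) mhg)).
exact: measurable_fun_pair my' mz'.
Qed.

Lemma measurable_potential : continuous f -> psdmx Gi ->
  measurable_fun [set: borel_rect R n 1 * borel_rect R n 1] potential.
Proof.
move=> cf Gi_psd.
have mf := @continuous_borel_measurable R 'cV[R]_n _ cf.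
have mq := @continuous_borel_measurable R 'cV[R]_n _ (@continuous_qform R n Gi).
rewrite (_ : potential = fun s =>
    f s.1 - f xstar + mu / 2 * qform Gi ((s.2 : 'cV[R]_n) - xstar)); last first.
  by apply/funext => s; rewrite /potential psdmx_normmx_sqr.
apply: measurable_funD; first apply: measurable_funB => //.
  by apply: (measurableT_comp mf); exact: measurable_fst.
apply: measurable_funM => //; apply: (measurableT_comp mq).
apply: measurable_addmx => //; exact: measurable_snd.
Qed.

End Update.

Section OneStep.
Context {R : realType} {n : nat} {d : measure_display} {T : measurableType d}.
Variables (P : probability T R) (H : {RV P >-> borel_mx R n}).
Hypotheses (n_gt0 : (0 < n)%N) (H_psd : forall w, psdmx (H w : 'M[R]_n)).
Hypothesis H_int : integrable_mx P (fun w => H w : 'M[R]_n).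
Let G := mean_mx P (fun w => H w : 'M[R]_n).
Hypothesis G_pd : pdmx G.
Let K := invmx (sqrtmx G).
Let A w := K *m (H w : 'M[R]_n) *m K.
Hypothesis A2_int : integrable_mx P (fun w => A w ^+ 2).
Let nu := lambda_max (mean_mx P (fun w => A w ^+ 2)).
Variables (f : 'cV[R]_n -> R) (mu : R) (xstar : 'cV[R]_n).
Hypotheses (f_cont : continuous f) (mu_gt0 : 0 < mu).
Hypothesis f_sc : strongly_convex f mu (invmx G).
Hypothesis f_lip : lipschitz_gradient f 1 (invmx G).
Hypothesis f_descent : forall x : 'cV[R]_n, {ae P, forall w,
  f (x - (H w : 'M[R]_n) *m grad f x) <=
  f x - 2^-1 * normmx (H w) (grad f x) ^+ 2}.
Hypothesis xstar_min : forall u, f xstar <= f u.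
Let tau := Num.sqrt (mu / nu).

Let nu_ge1 : 1 <= nu.
Proof. exact: lambda_max_ge1. Qed.

Let nu_gt0 : 0 < nu. Proof. exact: lt_le_trans nu_ge1. Qed.

Lemma rate_gt0 : 0 < tau.
Proof. by rewrite sqrtr_gt0 divr_gt0. Qed.

Lemma rate_le1 : tau <= 1.
Proof.
rewrite -sqrtr1 ler_wsqrtr// ler_pdivrMr// mul1r.
exact: le_trans (strong_convexity_le1 G_pd f_sc f_lip n_gt0) nu_ge1.
Qed.

Let rate_sqr : tau ^+ 2 * nu = mu.
Proof. by rewrite sqr_sqrtr ?divfK ?gt_eqF// divr_ge0// ltW. Qed.

Let Gi_psd : psdmx (invmx G) := pdmx_psdmx (pdmx_inv G_pd).

Lemma potential_ge0 s : 0 <= potential f mu (invmx G) xstar s.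
Proof.
rewrite /potential addr_ge0 ?subr_ge0// mulr_ge0 ?sqr_ge0//.
by rewrite divr_ge0// ltW.
Qed.

(** Bounding the potential after one step, by the descent property and by
   expanding the square, leaves an affine function of [H] and [A ^+ 2], whose
   mean is computed exactly. In that mean the term [- |g|_G^2 / 2] coming from
   the descent property pays for the second-moment term: this is what fixes the
   value [mu / nu] of [tau ^+ 2]. *)
Lemma one_step_contraction s :
  (\int[P]_w (potential f mu (invmx G) xstar (update f mu tau (s, H w)))%:E <=
   (1 - tau)%:E * (potential f mu (invmx G) xstar s)%:E)%E.
Proof.
have tau_gt0 := rate_gt0; have tau1_gt0 : 0 < 1 + tau by rewrite addr_gt0.
case: s => y z; pose x : 'cV[R]_n :=
  (1 / (1 + tau)) *: (y : 'cV[R]_n) + (tau / (1 + tau)) *: (z : 'cV[R]_n).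
pose g := grad f x.
pose u := (1 - tau) *: ((z : 'cV[R]_n) - xstar) + tau *: (x - xstar).
pose S := sqrtmx G.
pose c0 := f x - f xstar + mu / 2 * qform (invmx G) u.
(* The powers of [tau / mu] come from expanding the square of
   [u - (tau / mu) H g], multiplied by [mu / 2]. *)
pose B w := c0 + (- 2^-1) * dotv g ((H w : 'M[R]_n) *m g)
  + (- tau) * dotv (invmx G *m u) ((H w : 'M[R]_n) *m g)
  + (tau ^+ 2 / (2 * mu)) * dotv (S *m g) (A w ^+ 2 *m (S *m g)).
pose F w := potential f mu (invmx G) xstar (update f mu tau ((y, z), H w)).
have mF : measurable_fun [set: T] F.
  pose pot := @measurable_potential R n f mu (invmx G) xstar f_cont Gi_psd.
  pose stp := measurable_update mu tau (measurable_grad G_pd mu_gt0 f_sc f_lip).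
  apply: (measurableT_comp (measurableT_comp pot stp)).
  by apply: measurable_fun_pair.
have F0 w : 0 <= F w by exact: potential_ge0.
have FB : {ae P, forall w, F w <= B w}.
  have := f_descent x; apply: filterS => w; rewrite psdmx_normmx_sqr// => fw.
  rewrite /F /B /potential /= psdmx_normmx_sqr// -/x -/g.
  set h := (H w : 'M[R]_n) *m g.
  have -> : (z : 'cV[R]_n) + tau *: (x - z) - (tau / mu) *: h - xstar =
      u + - ((tau / mu) *: h).
    by apply/matrixP => i j; rewrite !mxE; ring.
  case: (Gi_psd) => Gi_sym _.
  rewrite qformD// qformN qformZ mulmxN -scalemxAr dotvNr dotvZr.
  rewrite (dotv_mulmxl (invmx G) u) Gi_sym.
  have -> : dotv (S *m g) (A w ^+ 2 *m (S *m g)) = qform (invmx G) h.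
    by rewrite /h (qform_inv_step H_psd G_pd).
  have -> : c0 = f x - f xstar + mu / 2 * qform (invmx G) u by [].
  have muE :
     mu / 2 * (qform (invmx G) u + 2 * - (tau / mu * dotv u (invmx G *m h))
       + (tau / mu) ^+ 2 * qform (invmx G) h) =
     mu / 2 * qform (invmx G) u - tau * dotv u (invmx G *m h) +
     tau ^+ 2 / (2 * mu) * qform (invmx G) h.
    by field; rewrite gt_eqF.
  rewrite muE; move: fw; rewrite /qform -/g -/h; lra.
have i1 := integrable_dotv H_int g g.
have i2 := integrable_dotv H_int (invmx G *m u) g.
have i3 := integrable_dotv A2_int (S *m g) (S *m g).
have c_int : P.-integrable [set: T] (fun=> c0%:E).
  exact: finite_measure_integrable_cst.
have j1 := integrableD measurableT c_int (integrableZl measurableT (- 2^-1) i1).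
have j2 := integrableD measurableT j1 (integrableZl measurableT (- tau) i2).
have j3 := integrableD measurableT j2
  (integrableZl measurableT (tau ^+ 2 / (2 * mu)) i3).
have mB : measurable_fun [set: T] B.
  by apply/measurable_EFinP; exact: measurable_int j3.
have intB : (\int[P]_w (B w)%:E = (c0 + (- 2^-1) * qform G g
    + (- tau) * dotv u g + (tau ^+ 2 / (2 * mu)) *
      qform (mean_mx P (fun w => A w ^+ 2)) (S *m g))%:E)%E.
  under eq_integral do rewrite /B !EFinD !EFinM.
  rewrite integralD//; last exact: integrableZl.
  rewrite integralD//; last exact: integrableZl.
  rewrite integralD//; last exact: integrableZl.
  rewrite !integralZl// !integral_dotv// integral_cst//= probability_setT mule1.
  rewrite -!EFinM -!EFinD; congr (_ + _ + _ * _ + _)%:E.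
  case: (Gi_psd) => Gi_sym _.
  by rewrite dotv_mulmxl Gi_sym mulKmx// pdmx_unit.
(* [B] is nonnegative almost everywhere only; its absolute value is a bound that
   is nonnegative everywhere and has the same integral. *)
apply: (@le_trans _ _ (\int[P]_w (`|B w|%R)%:E)%E).
  apply: ae_ge0_le_integral => //.
  - by move=> w _; rewrite lee_fin; exact: F0.
  - exact/measurable_EFinP.
  - by apply/measurable_EFinP; exact: measurableT_comp.
  - by apply: filterS FB => w FBw _; rewrite lee_fin (le_trans FBw)// ler_norm.
rewrite (ae_eq_integral (fun w => (B w)%:E))//; first last.
- apply: filterS FB => w FBw _; congr (_%:E); rewrite ger0_norm//.
  exact: le_trans FBw.
- exact/measurable_EFinP.
- by apply/measurable_EFinP; exact: measurableT_comp.
rewrite intB -EFinM lee_fin.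
have xE : (1 + tau) *: x = (y : 'cV[R]_n) + tau *: (z : 'cV[R]_n).
  rewrite /x scalerDr !scalerA ![(1 + tau) * _]mulrC.
  by rewrite !divfK ?gt_eqF// scale1r.
have core := accelerated_estimate G_pd mu_gt0 f_sc (ltW tau_gt0) rate_le1 xE
  (erefl u).
have var : tau ^+ 2 / (2 * mu) * qform (mean_mx P (fun w => A w ^+ 2)) (S *m g)
    <= 2^-1 * qform G g.
  have c3 : 0 <= tau ^+ 2 / (2 * mu).
    by rewrite divr_ge0 ?sqr_ge0// mulr_ge0// ltW.
  apply: le_trans (ler_wpM2l c3 (second_moment_le H_psd G_pd _)) _.
  rewrite -/nu mulrA; apply: ler_wpM2r; first by case: (pdmx_psdmx G_pd).
  rewrite le_eqVlt; apply/orP; left; apply/eqP.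
  rewrite mulrAC rate_sqr; field.
  by rewrite gt_eqF.
rewrite /potential /= psdmx_normmx_sqr//; move: core var.
rewrite -/g /c0; lra.
Qed.

End OneStep.

Theorem theorem3p4 (R : realType) (n : nat) (n_gt0 : (0 < n)%N)
    (* the random matrix H *)
    (d : measure_display) (T : measurableType d) (P : probability T R)
    (H : {RV P >-> borel_mx R n})
    (H_psd : forall w, psdmx (H w : 'M[R]_n))
    (H_int : integrable_mx P (fun w => H w : 'M[R]_n)) :
  let G := mean_mx P (fun w => H w : 'M[R]_n) in
  forall (G_pd : pdmx G)
    (* the objective function f *)
    (f : 'cV[R]_n -> R) (f_diff : forall x, differentiable f x)
    (mu : R) (mu_gt0 : 0 < mu)
    (f_sc : strongly_convex f mu (invmx G))
    (f_lip : lipschitz_gradient f 1 (invmx G))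
    (f_descent : forall x : 'cV[R]_n, {ae P, forall w,
       f (x - (H w : 'M[R]_n) *m grad f x) <=
       f x - 2^-1 * normmx (H w) (grad f x) ^+ 2}),
  let K := invmx (sqrtmx G) in
  let A := fun w => K *m (H w : 'M[R]_n) *m K in
  forall (A2_int : integrable_mx P (fun w => A w ^+ 2)),
  let nu := lambda_max (mean_mx P (fun w => A w ^+ 2)) in
  let tau := Num.sqrt (mu / nu) in
  forall (* the independent realizations H_0, H_1, ... of H *)
    (d' : measure_display) (Omega : measurableType d')
    (Q : probability Omega R) (Hs : nat -> {RV Q >-> borel_mx R n})
    (Hs_law : forall k, same_law (Hs k) H)
    (Hs_indep : mutually_independent Hs)
    (* the algorithm *)
    (x0 y0 z0 : 'cV[R]_n) (x y z : nat -> Omega -> 'cV[R]_n)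
    (x_init : forall w, x 0%N w = x0)
    (y_init : forall w, y 0%N w = y0)
    (z_init : forall w, z 0%N w = z0)
    (x_step : forall k w, x k.+1 w =
       (1 / (1 + tau)) *: y k w + (tau / (1 + tau)) *: z k w)
    (y_step : forall k w, y k.+1 w =
       x k.+1 w - (Hs k w : 'M[R]_n) *m grad f (x k.+1 w))
    (z_step : forall k w, z k.+1 w =
       z k w + tau *: (x k.+1 w - z k w)
       - (tau / mu) *: ((Hs k w : 'M[R]_n) *m grad f (x k.+1 w)))
    (xstar : 'cV[R]_n) (xstar_min : forall u, f xstar <= f u),
  let V := fun (u v : 'cV[R]_n) =>
    f u - f xstar + mu / 2 * normmx (invmx G) (v - xstar) ^+ 2 in
  forall k : nat,
    ('E_Q[fun w => V (y k w) (z k w)] <= ((1 - tau) ^+ k * V y0 z0)%:E)%E.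
Proof.
move=> G G_pd f f_diff mu mu_gt0 f_sc f_lip f_descent K A A2_int nu tau.
move=> d' Omega Q Hs Hs_law Hs_indep x0 y0 z0 x y z _ y_init z_init.
move=> x_step y_step z_step xstar xstar_min V k.
have f_cont : continuous f.
  by move=> u; exact: differentiable_continuous.
have Gi_psd := pdmx_psdmx (pdmx_inv G_pd).
pose v s := (potential f mu (invmx G) xstar s)%:E.
have mv : measurable_fun [set: borel_rect R n 1 * borel_rect R n 1] v.
  by apply/measurable_EFinP; exact: measurable_potential.
have v0 s : (0 <= v s)%E by rewrite lee_fin; exact: potential_ge0.
have mupd := measurable_update mu tau (measurable_grad G_pd mu_gt0 f_sc f_lip).
rewrite unlock EFinM.
apply: (@markov_contraction _ _ _ Q _ _ _ _ Hs Hs_indep (update f mu tau)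
  (y0, z0) (fun k w => (y k w, z k w)) mupd _ _ v) => //.
- by move=> w; rewrite y_init z_init.
- by move=> j w; rewrite /update /= y_step z_step x_step.
- rewrite subr_ge0.
  exact: (rate_le1 n_gt0 H_psd H_int G_pd A2_int f_sc f_lip).
move=> j s; rewrite (eq_measure_integral (distribution P H)); last first.
  by move=> B mB _; exact: Hs_law.
rewrite ge0_integral_distribution//; first exact:
    (one_step_contraction n_gt0 H_psd H_int G_pd A2_int f_cont mu_gt0 f_sc f_lip
      f_descent xstar_min).
have ms : measurable_fun [set: borel_mx R n] (fun h : borel_mx R n => (s, h)).
  exact: measurable_fun_pair.
exact: measurableT_comp mv (measurableT_comp mupd ms).
Qed.
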